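(* For every number $a\in(0,1)$ there exist polytopes $P_n\subset\mathbb{R}^n$ ($n\in\mathbb{N}$) such that $$\log|V_n|\sim n^{a}\quad\text{and}\quad \log|\mathcal{F}_n|\sim n^{1-a},$$ where $V_n$ and $\mathcal{F}_n$ are the sets of vertices and facets of $P_n$, and the constants implied in $\sim$ depend only on $a$.
   Context: A polytope in $\mathbb{R}^n$ is the convex hull of finitely many points with non-empty interior. Vertices are its $0$-dimensional faces and facets are its $(n-1)$-dimensional faces. For positive quantities $A_n,B_n$, $A_n\sim B_n$ means that there are constants $C_1,C_2>0$ independent of $n$ such that $C_1B_n\le A_n\le C_2B_n$ for all $n$. Logarithms are natural. *)

(* Defs.v *)
From HB Require Import structures.
From mathcomp Require Import all_boot all_order all_algebra finmap.
From mathcomp Require Import all_classical all_reals all_analysis.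

Set Implicit Arguments.
Unset Strict Implicit.
Unset Printing Implicit Defensive.

Import Order.TTheory GRing.Theory Num.Theory.
Import numFieldNormedType.Exports.

Local Open Scope classical_set_scope.
Local Open Scope ring_scope.

Section Polytopes.
Context {R : realType} {n : nat}.
Implicit Types P F A : set 'rV[R]_n.

Definition conv_hull A : set 'rV[R]_n :=
  smallest (fun C => convex_set (C : set (convex_lmodType 'rV[R]_n))) A.

Definition polytope P : Prop :=
  (exists s : seq 'rV[R]_n, P = conv_hull [set` s]) /\ P° !=set0.

Definition dotp (u x : 'rV[R]_n) : R := \sum_i u 0 i * x 0 i.

(* Intersections with supporting hyperplanes; the degenerate choice u = 0 gives
   the improper faces P (c = 0) and set0 (c > 0). *)
Definition face P F : Prop :=
  exists (u : 'rV[R]_n) (c : R),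
    (forall x, P x -> dotp u x <= c) /\ F = P `&` [set x | dotp u x = c].

Definition affine_hull A : set 'rV[R]_n :=
  [set x | exists (m : nat) (p : 'I_m -> 'rV[R]_n) (w : 'I_m -> R),
     [/\ forall i, A (p i), \sum_i w i = 1 & x = \sum_i w i *: p i]].

(* The empty set has no dimension in this sense. *)
Definition has_dim A (k : nat) : Prop :=
  exists (x0 : 'rV[R]_n) (U : {vspace 'rV[R]_n}),
    \dim U = k /\ affine_hull A = [set x | x - x0 \in U].

Definition faces (k : nat) P : set (set 'rV[R]_n) :=
  [set F | face P F /\ has_dim F k].

Definition vertices P := faces 0 P.

(* Meaningful for n > 0 only, because of the truncated predecessor. *)
Definition facets P := faces n.-1 P.

End Polytopes.

(* An infinite set gets cardset 0, hence ln 0 = 0, which the lower bound in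
   asymp below excludes when the right-hand side is positive. *)
Definition cardset {T : choiceType} (A : set T) : nat := #|` fset_set A |%fset.

(* A_n ~ B_n, with n ranging over the positive integers. *)
Definition asymp {R : realType} (A B : nat -> R) : Prop :=
  exists C1 C2 : R, [/\ 0 < C1, 0 < C2 &
    forall n, (0 < n)%N -> C1 * B n <= A n <= C2 * B n].

(* Main.v *)
Require Import Defs.
From HB Require Import structures.
From mathcomp Require Import all_boot all_order all_algebra finmap.
From mathcomp Require Import all_classical all_reals all_analysis.
From mathcomp Require Import ring lra zify.

Set Implicit Arguments.
Unset Strict Implicit.
Unset Printing Implicit Defensive.

Import Order.TTheory GRing.Theory Num.Theory.
Import numFieldNormedType.Exports.

Local Open Scope classical_set_scope.
Local Open Scope ring_scope.

(** The cube has exponentially many vertices and few facets, the cross-polytope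
    has few vertices and exponentially many facets, and the free sum of the two
    adds the numbers of vertices and multiplies the numbers of facets.  So the
    free sum of a cube of dimension p and a cross-polytope of dimension q has
    2^p vertices and 2^q facets, up to factors polynomial in p + q.  A pyramid
    over a polytope has one vertex and one facet more than its base, so
    iterated pyramids bring the dimension up to any n >= p + q at the cost of
    O(n) vertices and facets.  With p ~ n^a / 2 and q ~ n^(1-a) / 2 the factors
    polynomial in n only change the logarithms by O(log n), which is
    dominated by both n^a and n^(1-a).  The requirement p + q <= n can be met
    because (n^a - 1) (n^(1-a) - 1) >= 0 gives n^a + n^(1-a) <= n + 1.

    In coordinates, split the index set of R^n into X, Y and a remainder Z, with
    |X| = p and |Y| = q.  The polytope consists of the v with v_k >= 0 for k in
    Z and |v_i| + sum_(j notin X) |v_j| <= 1 for i in X.  Resolving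
    the absolute values gives its description by linear inequalities
    ([cube_cross_pyramid_polyhedron]); moving the coordinates in X one by one to
    the ends of their range shows that it is the convex hull of the cube
    vertices, the unit vectors e_j for j notin X and their opposites for j in Y
    ([cube_cross_pyramid_conv_hull]).

    Upper bounds on the numbers of faces hold for general reasons: every vertex
    of a convex hull is one of its generators ([vertices_conv_hull]) and
    every facet of a polyhedron is cut out by one of its inequalities
    ([facets_polyhedron]).  For the lower bounds it suffices to exhibit faces:
    each cube vertex uniquely maximizes the linear form that it defines, and
    each of the 2^(q+1) inequalities that involve a fixed coordinate i0 in X is
    tight at a point around which the polytope fills the whole supporting
    hyperplane ([facet_of_relative_interior]). *)

(** * Cardinalities of sets of faces *)

Section Cardinality.
Context {T : choiceType}.
Implicit Types A : set T.

Lemma finite_set_sub_image {I : eqType} (s : seq I) (f : I -> T) A :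
  A `<=` [set f i | i in [set` s]] -> finite_set A.
Proof. by move=> /sub_finite_set; apply; exact/finite_image/finite_seq. Qed.

Lemma cardset_le_size {I : eqType} (s : seq I) (f : I -> T) A :
  A `<=` [set f i | i in [set` s]] -> (cardset A <= size s)%N.
Proof.
move=> As; have Afin := finite_set_sub_image As.
rewrite -(size_map f) /cardset; apply: uniq_leq_size => [|x].
  exact: fset_uniq.
by rewrite in_fset_set // inE => /As[i /= si <-]; exact: map_f.
Qed.

Lemma card_le_cardset {I : finType} (D : {set I}) (f : I -> T) A :
  finite_set A -> {in D, forall i, A (f i)} -> {in D &, injective f} ->
  (#|D| <= cardset A)%N.
Proof.
move=> Afin DA finj; rewrite cardE -(size_map f) /cardset.
apply: uniq_leq_size => [|x].
  rewrite map_inj_in_uniq ?enum_uniq // => i j.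
  by rewrite !mem_enum; exact: finj.
by move=> /mapP[i]; rewrite mem_enum => /DA Ai ->; rewrite in_fset_set // inE.
Qed.

End Cardinality.

Section Polyhedra.
Context {R : realType} {n : nat}.
Implicit Types (P F A C : set 'rV[R]_n) (u v x y : 'rV[R]_n).

Lemma dotp_comb u s x t y :
  dotp u (s *: x + t *: y) = s * dotp u x + t * dotp u y.
Proof.
rewrite /dotp !mulr_sumr -big_split; apply: eq_bigr => i _ /=.
by rewrite !mxE; ring.
Qed.

Lemma dotpB u x y : dotp u (x - y) = dotp u x - dotp u y.
Proof. by have := dotp_comb u 1 x (-1) y; rewrite scale1r scaleN1r => ->; ring. Qed.

Lemma dotpD u x y : dotp u (x + y) = dotp u x + dotp u y.
Proof. by have := dotp_comb u 1 x 1 y; rewrite !scale1r => ->; ring. Qed.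

Lemma dotpZ u t x : dotp u (t *: x) = t * dotp u x.
Proof. by have := dotp_comb u t x 0 0; rewrite scale0r addr0 => ->; ring. Qed.

Lemma dotp_sum u (I : Type) (r : seq I) (p : I -> 'rV[R]_n) :
  dotp u (\sum_(i <- r) p i) = \sum_(i <- r) dotp u (p i).
Proof.
apply: (big_morph (dotp u)); first exact: dotpD.
by rewrite /dotp big1 // => i _; rewrite mxE mulr0.
Qed.

Lemma dotpC u v : dotp u v = dotp v u.
Proof. by apply: eq_bigr => i _; rewrite mulrC. Qed.

Lemma dotp_self_neq0 u : u != 0 -> dotp u u != 0.
Proof.
apply: contra_neq => /eqP; rewrite psumr_eq0 => [|i _]; last exact: sqr_ge0.
move=> /allP u0; apply/rowP => i; rewrite mxE; apply/eqP.
by have := u0 i (mem_index_enum _); rewrite /= mulf_eq0 orbb.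
Qed.

(** * Convex hulls *)

(** Convexity over real scalars, so that arithmetic tactics apply to the weights. *)
Definition segment_closed C := forall x y t,
  C x -> C y -> 0 <= t <= 1 -> C (t *: x + (1 - t) *: y).

Lemma segment_closed_convex_set C :
  segment_closed C <-> convex_set (C : set (convex_lmodType 'rV[R]_n)).
Proof.
split=> [Cc x y t /set_mem Cx /set_mem Cy|Cc x y t Cx Cy /andP[t0 t1]].
  by apply/mem_set/Cc => //; apply/andP; split; [exact: ge0|exact: le1].
pose k := @Itv01 R t t0 t1.
by have /set_mem := Cc x y k (mem_set Cx) (mem_set Cy).
Qed.

Lemma sub_conv_hull A : A `<=` conv_hull A.
Proof. exact: sub_gen_smallest. Qed.

Lemma conv_hull_min A C : segment_closed C -> A `<=` C -> conv_hull A `<=` C.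
Proof. by move=> /segment_closed_convex_set Cc AC; exact: smallest_sub. Qed.

Lemma conv_hull_segment_closed A : segment_closed (conv_hull A).
Proof.
move=> x y t hx hy t01 C [Cc AC].
by apply: (proj2 (segment_closed_convex_set C) Cc) => //; [exact: hx|exact: hy].
Qed.

(** Unnormalized weights spare a division when they all vanish: the total weight
    is then 0 and any point c of C will do, hence the witness c0. *)
Lemma segment_closed_weighted_sum C c0 (I : Type) (r : seq I) (Q : pred I) (w : I -> R)
    (p : I -> 'rV[R]_n) :
  segment_closed C -> C c0 -> (forall i, Q i -> 0 <= w i /\ C (p i)) ->
  exists2 c, C c & \sum_(i <- r | Q i) w i *: p i = (\sum_(i <- r | Q i) w i) *: c.
Proof.
move=> Cc Cc0 wp.
suff [c [Cc' _ ->]] : exists c, [/\ C c, 0 <= \sum_(i <- r | Q i) w i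
    & \sum_(i <- r | Q i) w i *: p i = (\sum_(i <- r | Q i) w i) *: c].
  by exists c.
elim: r => [|i r [c [Cc' W0 IH]]].
  by exists c0; rewrite !big_nil scale0r.
rewrite !big_cons; case: ifPn => [Qi|_]; last by exists c.
have [wi0 Cpi] := wp i Qi; rewrite IH; set W := \sum_(j <- r | Q j) w j in W0 *.
have [s0|s0] := eqVneq (w i + W) 0.
  have [-> ->] : w i = 0 /\ W = 0 by split; lra.
  by exists c; rewrite addr0 !scale0r addr0.
have sgt0 : 0 < w i + W by rewrite lt_def s0 addr_ge0.
exists ((w i / (w i + W)) *: p i + (1 - w i / (w i + W)) *: c); split => //.
- apply: Cc => //; rewrite divr_ge0 ?(ltW sgt0) //= ler_pdivrMr // mul1r; lra.
- exact: ltW.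
by rewrite scalerDr !scalerA; congr (_ *: _ + _ *: _); field; exact: s0.
Qed.

(** * Affine hulls *)

Lemma sub_affine_hull A : A `<=` affine_hull A.
Proof.
move=> x Ax; exists 1%N, (fun=> x), (fun=> 1); split => //.
  by rewrite big_ord1.
by rewrite big_ord1 scale1r.
Qed.

Lemma affine_hull_line A x y t :
  A x -> A y -> affine_hull A (x + t *: (y - x)).
Proof.
move=> Ax Ay; exists 2%N, (fun i : 'I_2 => if i == 0 then x else y),
  (fun i : 'I_2 => if i == 0 then 1 - t else t); split.
- by move=> i; case: ifP.
- by rewrite big_ord_recl big_ord1 /=; ring.
- by rewrite big_ord_recl big_ord1 /= scalerBl scale1r scalerBr addrA addrAC.
Qed.

Lemma affine_hull_hyperplane A u c :
  A `<=` [set x | dotp u x = c] -> affine_hull A `<=` [set x | dotp u x = c].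
Proof.
move=> Au x [m [p [w [Ap w1 ->]]]] /=; rewrite dotp_sum.
rewrite (eq_bigr (fun i => w i * c)) => [|i _]; last by rewrite dotpZ Au.
by rewrite -mulr_suml w1 mul1r.
Qed.

Lemma affine_hull_nonempty A x : affine_hull A x -> A !=set0.
Proof.
case=> -[|m] [p [w [Ap w1 _]]]; last by exists (p ord0).
by move: w1; rewrite big_ord0 => /eqP; rewrite eq_sym oner_eq0.
Qed.

(** Rank-nullity for the nonzero linear form defined by u. *)
Lemma dotp_kernel u : u != 0 ->
  exists2 U : {vspace 'rV[R]_n}, \dim U = n.-1 & forall x, (x \in U) = (dotp u x == 0).
Proof.
move=> u0.
pose f (x : 'rV[R]_n) : R^o := dotp u x.
have flin : linear f by move=> t x y; rewrite /f dotpD dotpZ.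
pose fl : {linear 'rV[R]_n -> R^o} := HB.pack f (GRing.isLinear.Build _ _ _ _ _ flin).
exists (lker (linfun fl)); last by move=> x; rewrite memv_ker lfunE.
have := limg_ker_dim (linfun fl) fullv; rewrite capfv dimvf /dim /= mul1n.
have -> : \dim (linfun fl @: fullv) = 1%N; last by rewrite addn1 => /(congr1 predn).
apply/eqP; rewrite eqn_leq; apply/andP; split.
  by rewrite (leq_trans (dimvS (subvf _))) // dimvf.
rewrite lt0n dimv_eq0; apply/eqP => im0.
have : linfun fl u \in (linfun fl @: fullv)%VS by rewrite memv_img // memvf.
by rewrite im0 memv0 lfunE /= (negPf (dotp_self_neq0 u0)).
Qed.

(** * Vertices *)

(** If the supporting form stayed strictly below its maximum c on all
    generators, then it would do so on the whole convex hull, so some generator lies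
    in the vertex; a set of affine dimension 0 has no other point. *)
Lemma vertices_conv_hull (s : seq 'rV[R]_n) :
  vertices (conv_hull [set` s]) `<=` [set [set x] | x in [set` s]].
Proof.
move=> F [[u [c [Pc ->]]] [x0 [U [/eqP U0 aff]]]].
have Fx x : (conv_hull [set` s] `&` [set x | dotp u x = c]) x -> x = x0.
  move=> /sub_affine_hull; rewrite aff /=.
  by move: U0; rewrite dimv_eq0 => /eqP ->; rewrite memv0 subr_eq0 => /eqP.
have [y Fy] : conv_hull [set` s] `&` [set x | dotp u x = c] !=set0.
  by apply: (@affine_hull_nonempty _ x0); rewrite aff /= subrr mem0v.
have [[x [xs xc]]|sltc] := pselect (exists x, x \in s /\ dotp u x = c).
  have Fx' : (conv_hull [set` s] `&` [set x | dotp u x = c]) x.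
    by split=> //; exact: sub_conv_hull.
  exists x => //; apply/seteqP; split => [z /= ->|z /Fx ->] //.
  by rewrite (Fx _ Fx').
have ltc : conv_hull [set` s] `<=` [set x | dotp u x < c].
  apply: conv_hull_min => [x y' t /= ux uy /andP[t0 t1]|x /= xs].
    rewrite dotp_comb; move: t0; rewrite le_eqVlt => /orP[/eqP <-|t0]; first by lra.
    by nra.
  rewrite lt_neqAle Pc ?andbT; last exact: sub_conv_hull.
  by apply/eqP => uxc; apply: sltc; exists x.
by case: Fy => /ltc /= + yc; rewrite yc ltxx.
Qed.

Lemma vertex_of_max P u c x :
  P x -> dotp u x = c -> (forall y, P y -> dotp u y <= c) ->
  (forall y, P y -> dotp u y = c -> y = x) -> vertices P [set x].
Proof.
move=> Px uxc Pc uniq; split.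
  exists u, c; split=> //; apply/seteqP; split=> y /=; first by move=> ->.
  by case=> Py; exact: uniq.
exists x, 0%VS; rewrite dimv0; split=> //.
apply/seteqP; split => y /=; rewrite memv0 subr_eq0.
  case=> m [p [w [Ap w1 ->]]].
  rewrite (eq_bigr (fun i => w i *: x)) => [|i _]; last by rewrite (Ap i).
  by rewrite -scaler_suml w1 scale1r.
by move=> /eqP ->; exact: sub_affine_hull.
Qed.

(** * Facets *)

Definition polyhedron (H : seq ('rV[R]_n * R)) : set 'rV[R]_n :=
  [set x | forall h, h \in H -> dotp h.1 x <= h.2].

Lemma polyhedron_segment_closed H : segment_closed (polyhedron H).
Proof.
move=> x y t Px Py /andP[t0 t1] h hH.
have := Px h hH; have := Py h hH; rewrite dotp_comb; nra.
Qed.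

(** A point that satisfies finitely many inequalities strictly can be moved a
    little in any prescribed direction. *)
Lemma polyhedron_strict_shift (H : seq ('rV[R]_n * R)) x w :
  (forall h, h \in H -> dotp h.1 x < h.2) ->
  exists2 t, 0 < t & polyhedron H (x + t *: w).
Proof.
move=> Hx.
(* The induction needs a bound that stays valid for all smaller shifts. *)
suff [t t0 Ht] : exists2 t, 0 < t &
    forall t', 0 <= t' <= t -> polyhedron H (x + t' *: w).
  by exists t => //; apply: Ht; rewrite (ltW t0) lexx.
elim: H Hx => [|h H IH] Hx; first by exists 1.
have [|t t0 Ht] := IH; first by move=> h' hH; apply: Hx; rewrite inE hH orbT.
have hx : dotp h.1 x < h.2 by apply: Hx; rewrite inE eqxx.
pose e := h.2 - dotp h.1 x; pose d := `|dotp h.1 w| + 1.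
have e0 : 0 < e by rewrite subr_gt0.
have d0 : 0 < d by rewrite ltr_wpDl.
exists (Num.min t (e / d)); first by rewrite lt_min t0 divr_gt0.
move=> t' /andP[t'0]; rewrite le_min => /andP[t't t'e] h'.
rewrite inE => /orP[/eqP ->|h'H]; last by apply: (Ht t') => //; rewrite t'0.
rewrite dotpD dotpZ -lerBrDl -/e (le_trans (ler_norm _)) // normrM ger0_norm //.
rewrite ler_pdivlMr // in t'e; apply: le_trans t'e.
by rewrite ler_wpM2l // lerDl.
Qed.

(** Averaging points at which single inequalities are strict makes all of them
    strict at once. *)
Lemma polyhedron_strict_point (H : seq ('rV[R]_n * R)) F :
  segment_closed F -> F !=set0 -> F `<=` polyhedron H ->
  (forall h, h \in H -> exists2 x, F x & dotp h.1 x < h.2) ->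
  exists2 x, F x & forall h, h \in H -> dotp h.1 x < h.2.
Proof.
move=> Fc [x0 Fx0]; elim: H => [|h H IH] FH Hex; first by exists x0.
have [||x Fx xH] := IH.
- by move=> x /FH xH h' h'H; apply: xH; rewrite inE h'H orbT.
- by move=> h' h'H; apply: Hex; rewrite inE h'H orbT.
have [y Fy yh] := Hex h (mem_head _ _).
exists (2^-1 *: x + (1 - 2^-1) *: y); first by apply: Fc => //; lra.
move=> h' h'H; rewrite dotp_comb.
have xh' := FH x Fx h' h'H; have yh' := FH y Fy h' h'H.
move: h'H; rewrite inE => /orP[/eqP h'E|/xH xltH]; last by lra.
by rewrite h'E in xh' yh' *; lra.
Qed.

(** Some inequality is tight on the whole facet F: otherwise a point of F
    satisfies all of them strictly, F contains a small shift of that point in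
    every direction, and its dimension is n.  By equality of dimensions, the
    affine hull of F is then the hyperplane of that inequality. *)
Lemma facets_polyhedron (H : seq ('rV[R]_n * R)) :
  (0 < n)%N -> (forall h, h \in H -> h.1 != 0) ->
  facets (polyhedron H) `<=`
    [set polyhedron H `&` [set x | dotp h.1 x = h.2] | h in [set` H]].
Proof.
move=> n0 H0 F [[u [c [Pc FE]]] [x0 [U [dimU aff]]]].
have FU x y : F x -> F y -> x - y \in U.
  move=> /sub_affine_hull + /sub_affine_hull; rewrite aff /= => xU yU.
  by have := memvB xU yU; rewrite opprB addrA subrK.
have [y Fy] : F !=set0.
  by apply: (@affine_hull_nonempty _ x0); rewrite aff /= subrr mem0v.
have Fc : segment_closed F.
  rewrite FE => x z t [Px xc] [Pz zc] t01; split.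
    exact: polyhedron_segment_closed.
  by rewrite /= dotp_comb xc zc; ring.
have FP : F `<=` polyhedron H by rewrite FE => x [].
have [[h hH Fh]|nh] :=
    pselect (exists2 h, h \in H & F `<=` [set x | dotp h.1 x = h.2]).
  exists h => //.
  have [K dimK KE] := dotp_kernel (H0 h hH).
  have affh := affine_hull_hyperplane Fh.
  have affu : affine_hull F `<=` [set x | dotp u x = c].
    by apply: affine_hull_hyperplane; rewrite FE => x [].
  have x0h : dotp h.1 x0 = h.2 by apply: affh; rewrite aff /= subrr mem0v.
  have UK : (U <= K)%VS.
    apply/subvP => w wU; rewrite KE.
    have : affine_hull F (x0 + w) by rewrite aff /= addrAC subrr add0r.
    by move=> /affh /=; rewrite dotpD x0h => /eqP; rewrite -subr_eq0 addrAC subrr add0r.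
  have /eqP UKE : U == K by rewrite eqEdim UK dimU dimK leqnn.
  apply/seteqP; split => x /=; last by move=> Fx; split; [exact: FP|exact: Fh].
  move=> [Px xh]; rewrite FE; split=> //; apply: affu; rewrite aff /=.
  by rewrite UKE KE dotpB xh x0h subrr.
have [z Fz zH] : exists2 x, F x & forall h, h \in H -> dotp h.1 x < h.2.
  apply: polyhedron_strict_point => //; first by exists y.
  move=> h hH; have [//|nlt] := pselect (exists2 x, F x & dotp h.1 x < h.2).
  exfalso; apply: nh; exists h => // x Fx /=; apply/eqP.
  rewrite eq_le (FP x Fx h hH) leNgt; apply/negP => xh; apply: nlt.
  by exists x.
have uz : dotp u z = c by move: Fz; rewrite FE => -[].
(* The form u is maximal at z, an interior point of P: u is zero. *)
have ule w : dotp u w <= 0.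
  have [t t0 /Pc] := polyhedron_strict_shift w zH.
  by rewrite dotpD uz dotpZ gerDl pmulr_rle0.
have u0 w : dotp u w = 0.
  apply/eqP; rewrite eq_le ule /=.
  by have := ule (-1 *: w); rewrite dotpZ mulN1r oppr_le0.
have : (fullv <= U)%VS.
  apply/subvP => w _; have [t t0 Pt] := polyhedron_strict_shift w zH.
  have : F (z + t *: w) by rewrite FE; split=> //=; rewrite u0 -uz u0.
  move=> /FU /(_ Fz); rewrite addrAC subrr add0r => tw.
  by rewrite -(scalerK (lt0r_neq0 t0) w) memvZ.
by move=> /dimvS; rewrite dimvf /dim /= mul1n dimU leqNgt prednK // leqnn.
Qed.

(** If P fills its supporting hyperplane around x, every point y of the
    hyperplane lies on a line through x and a nearby point of P. *)
Lemma facet_of_relative_interior P u x (c d : R) :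
  u != 0 -> (forall y, P y -> dotp u y <= c) -> dotp u x = c -> 0 < d ->
  (forall y, dotp u y = c -> (forall i, `|y 0 i - x 0 i| <= d) -> P y) ->
  facets P (P `&` [set y | dotp u y = c]).
Proof.
move=> u0 Pc uxc d0 Pball; split; first by exists u, c.
have [K dimK KE] := dotp_kernel u0; exists x, K; split => //.
have Px : P x by apply: Pball => // i; rewrite subrr normr0 ltW.
apply/seteqP; split => [y|y /=].
  move=> /(affine_hull_hyperplane (@subIsetr _ _ _)) /= yc.
  by rewrite KE dotpB yc uxc subrr.
rewrite KE dotpB uxc subr_eq0 => /eqP yc.
(* A crude bound on the distance from y to x, positive even if y = x. *)
pose m := 1 + \sum_i `|y 0 i - x 0 i|; have m0 : 0 < m.
  by rewrite ltr_pwDl ?ltr01 ?sumr_ge0.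
pose t := d / m; have t0 : 0 < t by rewrite divr_gt0.
pose z := x + t *: (y - x).
have zc : dotp u z = c by rewrite dotpD dotpZ dotpB yc uxc subrr mulr0 addr0.
have -> : y = x + t^-1 *: (z - x).
  by rewrite /z addrAC subrr add0r scalerK ?gt_eqF // addrC subrK.
apply: affine_hull_line; split => //; apply: Pball => // i.
rewrite /z !mxE addrAC subrr add0r normrM gtr0_norm //.
rewrite /t mulrAC ler_pdivrMr // ler_wpM2l ?(ltW d0) //.
by rewrite /m (bigD1 i) //= addrCA lerDl addr_ge0 // sumr_ge0.
Qed.

End Polyhedra.

(** * A pyramid over the free sum of a cube and a cross-polytope *)

Section CubeCrossPyramid.
Context {R : realType} {n : nat} (X Y : {set 'I_n}) (i0 : 'I_n).
Context (XY : {in Y, forall j, j \notin X}) (i0X : i0 \in X).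
Implicit Types (v y : 'rV[R]_n) (E : {set 'I_n}) (b : bool) (Eb : {set 'I_n} * bool).

Definition outer_norm v : R := \sum_(j | j \notin X) `|v 0 j|.

(** The cube lives in the coordinates in X, the cross-polytope in those in Y,
    and each remaining coordinate is the height of a pyramid. *)
Definition cube_cross_pyramid : set 'rV[R]_n :=
  [set v : 'rV[R]_n | (forall k, k \notin X :|: Y -> 0 <= v 0 k) /\
           (forall i, i \in X -> `|v 0 i| + outer_norm v <= 1)].

Lemma sign_mul_le b (x : R) : (-1) ^+ b * x <= `|x|.
Proof. by rewrite (le_trans (ler_norm _)) // normrMsign. Qed.

Lemma sign_mul_normE (x : R) : (-1) ^+ (x < 0)%R * x = `|x|.
Proof. by rewrite -normrEsign. Qed.

Lemma norm_sign_mul b (x : R) : 0 <= (-1) ^+ b * x -> `|x| = (-1) ^+ b * x.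
Proof. by move=> /ger0_norm <-; rewrite normrMsign. Qed.

Lemma outer_norm_ge0 v : 0 <= outer_norm v.
Proof. by rewrite sumr_ge0. Qed.

(** * The inequalities *)

(** One way of resolving the absolute values in |v_i| + outer_norm v <= 1; the
    set E and the bit b mark the coordinates that get a minus sign. *)
Definition facet_normal E i b : 'rV[R]_n :=
  \row_j if j \in X then (if j == i then (-1) ^+ b else 0) else (-1) ^+ (j \in E).

Definition inequalities : seq ('rV[R]_n * R) :=
  [seq (facet_normal t.1.1 t.1.2 t.2, 1)
     | t <- enum (finset.setX (finset.setX (powerset Y) X) [set: bool]%SET)] ++
  [seq (- delta_mx 0 k, 0) | k <- enum (~: (X :|: Y))].

Lemma dotp_facet_normal E i b v : i \in X ->
  dotp (facet_normal E i b) v =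
    (-1) ^+ b * v 0 i + \sum_(j | j \notin X) (-1) ^+ (j \in E) * v 0 j.
Proof.
move=> iX; rewrite /dotp (bigID (mem X)) /=; congr (_ + _).
  rewrite (bigD1 i) //= big1 ?addr0 => [|j /andP[jX ji]].
    by rewrite mxE iX eqxx.
  by rewrite mxE jX (negPf ji) mul0r.
by apply: eq_bigr => j jX; rewrite mxE (negPf jX).
Qed.

Lemma dotp_opp_delta k v : dotp (- delta_mx 0 k) v = - v 0 k.
Proof.
rewrite /dotp (bigD1 k) //= big1 ?addr0 => [|j jk].
  by rewrite !mxE !eqxx mulN1r.
by rewrite !mxE (negPf jk) andbF oppr0 mul0r.
Qed.

Lemma inequalitiesP (Q : 'rV[R]_n * R -> Prop) :
  (forall E i b, E \subset Y -> i \in X -> Q (facet_normal E i b, 1)) ->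
  (forall k, k \notin X :|: Y -> Q (- delta_mx 0 k, 0)) ->
  forall h, h \in inequalities -> Q h.
Proof.
move=> Q1 Q2 h; rewrite mem_cat => /orP[] /mapP[].
  move=> [[E i] b]; rewrite mem_enum !inE /= => /andP[/andP[EY iX] _] ->.
  exact: Q1.
by move=> k; rewrite mem_enum inE => kXY ->; exact: Q2.
Qed.

Lemma cube_cross_pyramid_polyhedron : cube_cross_pyramid = polyhedron inequalities.
Proof.
apply/seteqP; split => v.
  move=> [vZ vX]; apply: inequalitiesP => [E i b EY iX|k kXY] /=.
    rewrite dotp_facet_normal // (le_trans _ (vX i iX)) // lerD ?sign_mul_le //.
    by apply: ler_sum => j _; exact: sign_mul_le.
  by rewrite dotp_opp_delta oppr_le0 vZ.
move=> vH.
have vZ k : k \notin X :|: Y -> 0 <= v 0 k.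
  move=> kXY; have := vH (- delta_mx 0 k, 0); rewrite /= dotp_opp_delta oppr_le0.
  apply; rewrite mem_cat; apply/orP; right; apply/mapP; exists k => //.
  by rewrite mem_enum inE.
(* The sign pattern of v turns the inequality for i into the one with |v_i|. *)
split=> // i iX; pose E := [set j in Y | v 0 j < 0]%SET.
have := vH (facet_normal E i (v 0 i < 0)%R, 1).
rewrite /= dotp_facet_normal // sign_mul_normE.
rewrite (eq_bigr (fun j => `|v 0 j|)) => [|j jX]; first apply.
  rewrite mem_cat; apply/orP; left; apply/mapP.
  exists (E, i, (v 0 i < 0)%R) => //; rewrite mem_enum !inE iX /= !andbT.
  by apply/fintype.subsetP => j; rewrite inE => /andP[].
rewrite inE; have [jY|jY] /= := boolP (j \in Y); first exact: sign_mul_normE.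
by rewrite mul1r ger0_norm // vZ // inE negb_or jX.
Qed.

Lemma inequalities_neq0 h : h \in inequalities -> h.1 != 0.
Proof.
move: h; apply: inequalitiesP => [E i b _ iX|k _] /=.
  apply/eqP => /rowP/(_ i); rewrite !mxE iX eqxx => /eqP.
  by rewrite signr_eq0.
rewrite oppr_eq0; apply/eqP => /rowP/(_ k); rewrite !mxE !eqxx => /eqP.
by rewrite oner_eq0.
Qed.

Lemma size_inequalities : (size inequalities <= 2 ^ #|Y|.+1 * (3 * n))%N.
Proof.
have n0 : (0 < n)%N by case: (n) i0 => [[]|].
rewrite size_cat !size_map -!cardE !cardsX cardsT card_bool card_powerset.
have Xn : (2 ^ #|Y| * #|X| <= 2 ^ #|Y| * n)%N.
  by rewrite leq_mul2l -[X in (_ <= X)%N]card_ord max_card orbT.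
have : (#|~: (X :|: Y)| <= n)%N by rewrite -[leqRHS]card_ord max_card.
have : (n <= 2 ^ #|Y| * n)%N by rewrite leq_pmull // expn_gt0.
rewrite expnS.
by move: Xn; move: (2 ^ _)%N #|X| #|~: _| => ? ? ?; lia.
Qed.

Lemma segment_closed_cube_cross_pyramid : segment_closed cube_cross_pyramid.
Proof. by rewrite cube_cross_pyramid_polyhedron; exact: polyhedron_segment_closed. Qed.

(** * The generators *)

Definition cube_vertex E : 'rV[R]_n :=
  \row_j if j \in X then (-1) ^+ (j \in E) else 0.

Definition generators : seq 'rV[R]_n :=
  [seq cube_vertex E | E <- enum (powerset X)] ++
  [seq (-1) ^+ (jb.2 : bool) *: delta_mx 0 jb.1 |
     jb <- enum [set jb : 'I_n * bool | (jb.1 \notin X) && (jb.2 ==> (jb.1 \in Y))]%SET].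

Lemma generatorsP (Q : 'rV[R]_n -> Prop) :
  (forall E, E \subset X -> Q (cube_vertex E)) ->
  (forall j b, j \notin X -> (b -> j \in Y) -> Q ((-1) ^+ b *: delta_mx 0 j)) ->
  forall v, v \in generators -> Q v.
Proof.
move=> Q1 Q2 v; rewrite mem_cat => /orP[] /mapP[].
  by move=> E; rewrite mem_enum inE => EX ->; exact: Q1.
move=> [j b]; rewrite mem_enum inE /= => /andP[jX /implyP bY] ->.
exact: Q2.
Qed.

Lemma cube_vertex_generators E : E \subset X -> cube_vertex E \in generators.
Proof.
move=> EX; rewrite mem_cat; apply/orP; left; apply/mapP; exists E => //.
by rewrite mem_enum inE.
Qed.

Lemma axis_generators j b : j \notin X -> (b -> j \in Y) ->
  (-1) ^+ b *: delta_mx 0 j \in generators.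
Proof.
move=> jX bY; rewrite mem_cat; apply/orP; right; apply/mapP; exists (j, b) => //.
by rewrite mem_enum inE /= jX; exact/implyP.
Qed.

Lemma size_generators : (size generators <= 2 ^ #|X| * (3 * n))%N.
Proof.
have n0 : (0 < n)%N by case: (n) i0 => [[]|].
rewrite size_cat !size_map -!cardE card_powerset.
have := max_card [set jb : 'I_n * bool | (jb.1 \notin X) && (jb.2 ==> (jb.1 \in Y))]%SET.
rewrite card_prod card_ord card_bool.
have : (n <= 2 ^ #|X| * n)%N by rewrite leq_pmull // expn_gt0.
have : (2 ^ #|X| <= 2 ^ #|X| * n)%N by rewrite leq_pmulr.
by move: (2 ^ _)%N => ?; lia.
Qed.

Lemma cube_vertex_polytope E : cube_cross_pyramid (cube_vertex E).
Proof.
have N0 : outer_norm (cube_vertex E) = 0.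
  by rewrite /outer_norm big1 // => j jX; rewrite mxE (negPf jX) normr0.
split=> [k|i iX]; first by rewrite inE negb_or => /andP[kX _]; rewrite mxE (negPf kX).
by rewrite N0 addr0 mxE iX normr_sign.
Qed.

Lemma generators_polytope v : v \in generators -> cube_cross_pyramid v.
Proof.
move: v; apply: generatorsP => [E _|j b jX bY]; first exact: cube_vertex_polytope.
split=> [k|i iX].
  rewrite inE negb_or => /andP[kX kY]; rewrite !mxE /=.
  have [kj|_] := eqVneq k j; last by rewrite mulr0.
  by case: b bY => [bY|_]; [rewrite kj bY in kY|rewrite mul1r].
rewrite /outer_norm (bigD1 j) //= big1 => [|k /andP[_ kj]].
  rewrite !mxE !eqxx (_ : i == j = false) ?mulr0 ?mulr1 ?normr0 ?normr_sign ?addr0 ?add0r //.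
  by apply/eqP => ij; rewrite -ij iX in jX.
by rewrite !mxE (negPf kj) mulr0 normr0.
Qed.

Lemma outer_part_decomposition v :
  \sum_(j | j \notin X) `|v 0 j| *: ((-1) ^+ (v 0 j < 0)%R *: delta_mx 0 j) =
  \row_j (if j \in X then 0 else v 0 j).
Proof.
rewrite [RHS]row_sum_delta [RHS](bigID (mem X)) /= [X in _ = X + _]big1 => [|j jX].
  rewrite add0r; apply: eq_bigr => j jX.
  by rewrite mxE (negPf jX) scalerA mulrC -numEsign.
by rewrite mxE jX scale0r.
Qed.

Definition set_coord v i (s : R) : 'rV[R]_n := \row_j if j == i then s else v 0 j.

Lemma outer_norm_set_coord v i s : i \in X ->
  outer_norm (set_coord v i s) = outer_norm v.
Proof.
move=> iX; apply: eq_bigr => j jX; rewrite mxE ifN //.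
by apply: contraNneq jX => ->.
Qed.

(** Induction on the number of coordinates i in X for which |v_i| is smaller than
    the maximal value M = 1 - outer_norm v.  Such a v is between the two
    points obtained by replacing v_i with M and -M.  If there is none, v is
    M times a cube vertex plus the sum of the |v_j| (+-e_j) for j notin X, and
    these coefficients sum to 1. *)
Lemma cube_cross_pyramid_sub_conv_hull : cube_cross_pyramid `<=` conv_hull [set` generators].
Proof.
move=> v.
have [k] := ubnP #|[set i in X | `|v 0 i| != 1 - outer_norm v]%SET|.
elim: k v => // k IH v; rewrite ltnS => card_k Pv.
have [vZ vX] := Pv; set M := 1 - outer_norm v in card_k *.
have M0 : 0 <= M by have := vX i0 i0X; have := normr_ge0 (v 0 i0); rewrite /M; lra.
have N0 := outer_norm_ge0 v.
have hullC := @conv_hull_segment_closed _ _ [set` generators].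
have [S0|[i]] := set_0Vmem [set i in X | `|v 0 i| != M]%SET.
  pose E := [set i in X | v 0 i < 0]%SET.
  have hE : conv_hull [set` generators] (cube_vertex E).
    apply: sub_conv_hull; apply: cube_vertex_generators.
    by apply/fintype.subsetP => i; rewrite inE => /andP[].
  have [|c hc cE] := @segment_closed_weighted_sum _ _ _ _ 'I_n (index_enum 'I_n)
    (fun j => j \notin X) (fun j => `|v 0 j|)
    (fun j => (-1) ^+ (v 0 j < 0)%R *: delta_mx 0 j) hullC hE.
    move=> j jX; split=> //; apply: sub_conv_hull; apply: axis_generators => //.
    by apply: contraTT => jY; rewrite -leNgt vZ // inE negb_or jX.
  have -> : v = M *: cube_vertex E + (1 - M) *: c.
    rewrite (_ : 1 - M = outer_norm v); last by rewrite /M; ring.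
    rewrite -cE outer_part_decomposition; apply/rowP => j; rewrite !mxE inE.
    have [jX|jX] /= := boolP (j \in X); last by rewrite mulr0 add0r.
    have /eqP : j \notin [set i in X | `|v 0 i| != M]%SET by rewrite S0 inE.
    rewrite inE jX /= eqb_id negbK => /eqP <-.
    by rewrite addr0 mulrC -numEsign.
  by apply: hullC => //; rewrite M0 /M; lra.
rewrite inE => /andP[iX viM].
have viM' : `|v 0 i| <= M by have := vX i iX; rewrite /M; lra.
have Mgt0 : 0 < M.
  by rewrite lt_neqAle M0 andbT eq_sym; apply: contra_neq viM => M00;
     apply/eqP; rewrite eq_le viM' M00 normr_ge0.
have step s : `|s| = M -> conv_hull [set` generators] (set_coord v i s).
  move=> sM; apply: IH.
    apply: leq_trans card_k; rewrite [X in (_ < X)%N](cardsD1 i) inE iX viM /= add1n ltnS.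
    apply: subset_leq_card; apply/fintype.subsetP => j.
    rewrite !inE outer_norm_set_coord // mxE.
    by have [->|_] := eqVneq j i; rewrite ?sM ?eqxx ?andbF.
  split=> [l lXY|j jX].
    rewrite mxE ifN ?vZ //; apply: contraNneq lXY => ->.
    by rewrite inE iX.
  rewrite outer_norm_set_coord // mxE; case: ifP => _; last exact: vX.
  by rewrite sM /M; lra.
have -> : v = ((1 + v 0 i / M) / 2) *: set_coord v i M
            + (1 - (1 + v 0 i / M) / 2) *: set_coord v i (- M).
  apply/rowP => j; rewrite !mxE; case: eqP => [->|_]; last by ring.
  by field; rewrite gt_eqF.
apply: hullC; [apply: step|apply: step|].
- by rewrite ger0_norm.
- by rewrite normrN ger0_norm.
have : `|v 0 i / M| <= 1 by rewrite normrM normfV (ger0_norm M0) ler_pdivrMr // mul1r.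
by rewrite ler_norml; lra.
Qed.

Lemma cube_cross_pyramid_conv_hull : cube_cross_pyramid = conv_hull [set` generators].
Proof.
apply/seteqP; split; first exact: cube_cross_pyramid_sub_conv_hull.
apply: conv_hull_min; first exact: segment_closed_cube_cross_pyramid.
by move=> v; exact: generators_polytope.
Qed.

(** The constant s is so small that a ball of radius s around the point with
    coordinates 0 on X and s elsewhere satisfies |v_i| + outer_norm v <=
    2 s (n + 1) = 1. *)
Lemma cube_cross_pyramid_interior : cube_cross_pyramid° !=set0.
Proof.
pose s : R := (2 * n.+1%:R)^-1.
have s0 : 0 < s by rewrite invr_gt0 mulr_gt0.
exists (\row_j if j \in X then 0 else s); apply/nbhs_ballP; exists s => // v vs.
have {}vs j : `|(if j \in X then 0 else s) - v 0 j| < s.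
  by have [_ /(_ 0 j)] := vs; rewrite /ball /= mxE.
split=> [k|i iX].
  rewrite inE negb_or => /andP[kX _]; have := vs k.
  by rewrite (negPf kX) ltr_norml; lra.
have vi : `|v 0 i| <= 2 * s.
  by have := vs i; rewrite iX sub0r normrN; lra.
have vN : outer_norm v <= (2 * s) *+ n.
  apply: (@le_trans _ _ (\sum_(j | j \notin X) 2 * s)).
    apply: ler_sum => j jX; have := vs j; rewrite (negPf jX) ler_norml ltr_norml; lra.
  rewrite sumr_const ler_wpMn2l ?mulr_ge0 ?(ltW s0) //; by rewrite -[leqRHS]card_ord max_card.
rewrite (le_trans (lerD vi vN)) // -mulrS -[_ *+ n.+1]mulr_natr.
have -> : 2 * s * n.+1%:R = 1 by rewrite /s mulrAC divff // mulf_neq0 // pnatr_eq0.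
by [].
Qed.

Lemma polytope_cube_cross_pyramid : polytope cube_cross_pyramid.
Proof.
split; last exact: cube_cross_pyramid_interior.
by exists generators; exact: cube_cross_pyramid_conv_hull.
Qed.

(** * Counting *)

Lemma vertices_cube_cross_pyramid_sub :
  vertices cube_cross_pyramid `<=` [set [set x] | x in [set` generators]].
Proof. by rewrite cube_cross_pyramid_conv_hull; exact: vertices_conv_hull. Qed.

Lemma dotp_cube_vertex E v :
  dotp (cube_vertex E) v = \sum_(j in X) (-1) ^+ (j \in E) * v 0 j.
Proof.
rewrite /dotp (bigID (mem X)) /= [X in _ + X]big1 ?addr0 => [|j jX].
  by apply: eq_bigr => j jX; rewrite mxE jX.
by rewrite mxE (negPf jX) mul0r.
Qed.

(** On the polytope, |v_i| <= 1 for i in X, so the sum of the signed coordinates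
    is at most |X|, and equality forces v_i to be the prescribed sign; then
    |v_i0| = 1 leaves no room for the other coordinates. *)
Lemma cube_vertex_vertices E : vertices cube_cross_pyramid [set cube_vertex E].
Proof.
have Pcoord y j : cube_cross_pyramid y -> j \in X -> `|y 0 j| <= 1.
  by move=> [_ yX] jX; have := yX j jX; have := outer_norm_ge0 y; lra.
have Pdef y : cube_cross_pyramid y ->
    forall j, j \in X -> 0 <= 1 - (-1) ^+ (j \in E) * y 0 j.
  by move=> Py j jX; rewrite subr_ge0 (le_trans (sign_mul_le _ _)) // Pcoord.
have gap y : #|X|%:R - dotp (cube_vertex E) y =
    \sum_(j in X) (1 - (-1) ^+ (j \in E) * y 0 j).
  by rewrite sumrB sumr_const dotp_cube_vertex.
apply: (@vertex_of_max _ _ _ (cube_vertex E) #|X|%:R).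
- exact: cube_vertex_polytope.
- apply/eqP; rewrite eq_sym -subr_eq0 gap big1 // => j jX.
  by rewrite mxE jX -expr2 sqrr_sign subrr.
- by move=> y Py; rewrite -subr_ge0 gap sumr_ge0 //; exact: Pdef.
move=> y Py /eqP; rewrite eq_sym -subr_eq0 gap psumr_eq0; last exact: Pdef.
move=> /allP y1.
have {}y1 j : j \in X -> y 0 j = (-1) ^+ (j \in E).
  move=> jX; have := y1 j (mem_index_enum _); rewrite jX /= subr_eq0 => /eqP e.
  by rewrite -[y 0 j](signrMK (j \in E)) -e mulr1.
have yN : outer_norm y = 0.
  apply/eqP; rewrite eq_le outer_norm_ge0 andbT.
  have [_ /(_ i0 i0X)] := Py; rewrite y1 // normr_sign; lra.
apply/rowP => j; rewrite mxE; case: ifPn => [/y1 //|jX].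
move/eqP: yN; rewrite psumr_eq0 // => /allP /(_ j (mem_index_enum _)).
by rewrite jX /= normr_eq0 => /eqP.
Qed.

Lemma sign_inj : injective (fun b : bool => (-1) ^+ b : R).
Proof. by move=> [] [] //=; rewrite ?expr0 ?expr1; lra. Qed.

Lemma card_vertices_cube_cross_pyramid :
  (2 ^ #|X| <= cardset (vertices cube_cross_pyramid) <= 2 ^ #|X| * (3 * n))%N.
Proof.
apply/andP; split; last first.
  exact: leq_trans (cardset_le_size vertices_cube_cross_pyramid_sub) size_generators.
rewrite -card_powerset; apply: (card_le_cardset (f := fun E => [set cube_vertex E])).
- exact: finite_set_sub_image vertices_cube_cross_pyramid_sub.
- by move=> E _; exact: cube_vertex_vertices.
move=> E E' /=; rewrite !inE => EX EX' EE'.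
have /rowP eqE : cube_vertex E = cube_vertex E'.
  by have : [set cube_vertex E] (cube_vertex E) by []; rewrite EE'.
apply/setP => j; have := eqE j; rewrite !mxE; case: ifPn => [_ /sign_inj //|jX _].
by rewrite !(contraNF (fintype.subsetP _ _) jX).
Qed.

Lemma facets_cube_cross_pyramid_sub : facets cube_cross_pyramid `<=`
  [set cube_cross_pyramid `&` [set x | dotp h.1 x = h.2] | h in [set` inequalities]].
Proof.
rewrite cube_cross_pyramid_polyhedron; apply: facets_polyhedron.
  by case: (n) i0 => [[]|].
exact: inequalities_neq0.
Qed.

(** Fixing the coordinate i0 in X gives 2^(|Y| + 1) inequalities, enough for the
    lower bound on the number of facets. *)
Definition pivot_normal Eb := facet_normal Eb.1 i0 Eb.2.

Lemma dotp_pivot_normal Eb :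
  dotp (pivot_normal Eb) (pivot_normal Eb) = 1 + #|[pred j | j \notin X]|%:R.
Proof.
rewrite dotp_facet_normal // mxE i0X eqxx -expr2 sqrr_sign; congr (_ + _).
rewrite -sumr_const; apply: eq_bigr => j jX.
by rewrite mxE (negPf jX) -expr2 sqrr_sign.
Qed.

Lemma dotp_pivot_normal_gt0 Eb : 0 < dotp (pivot_normal Eb) (pivot_normal Eb).
Proof. by rewrite dotp_pivot_normal ltr_pwDl. Qed.

(** The multiple s *: u of a normal vector u on its hyperplane has coordinates
    +-s where u is supported and 0 elsewhere.  Moving them by at most s / 2
    keeps all signs, so that the hyperplane equation reads
    |y_i0| + outer_norm y = 1, and keeps |y_i| <= |y_i0| for the other i in X. *)
Lemma facet_relative_interior Eb y : Eb.1 \subset Y ->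
  let s := (dotp (pivot_normal Eb) (pivot_normal Eb))^-1 in
  dotp (pivot_normal Eb) y = 1 ->
  (forall i, `|y 0 i - (s *: pivot_normal Eb) 0 i| <= s / 2) ->
  cube_cross_pyramid y.
Proof.
move=> EY s; have s0 : 0 < s by rewrite invr_gt0 dotp_pivot_normal_gt0.
rewrite dotp_facet_normal // => yu yx.
have near_sign (b : bool) (z : R) : `|z - s * (-1) ^+ b| <= s / 2 ->
    s / 2 <= (-1) ^+ b * z.
  by rewrite ler_norml; case: b; rewrite ?expr0 ?expr1; lra.
have y0 : s / 2 <= (-1) ^+ Eb.2 * y 0 i0.
  by apply: near_sign; have := yx i0; rewrite !mxE i0X eqxx.
have yout j : j \notin X -> s / 2 <= (-1) ^+ (j \in Eb.1) * y 0 j.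
  by move=> jX; apply: near_sign; have := yx j; rewrite !mxE (negPf jX).
have y0E : `|y 0 i0| = (-1) ^+ Eb.2 * y 0 i0 by apply: norm_sign_mul; lra.
have yNE : outer_norm y = \sum_(j | j \notin X) (-1) ^+ (j \in Eb.1) * y 0 j.
  by apply: eq_bigr => j /yout yj; apply: norm_sign_mul; lra.
rewrite -y0E -yNE in yu; split=> [k|i iX].
  rewrite inE negb_or => /andP[/yout + kY].
  by rewrite (contraNF (fintype.subsetP EY k) kY) mul1r; lra.
rewrite -yu lerD2r; have [->//|ii0] := eqVneq i i0.
have := yx i; rewrite !mxE iX (negPf ii0) mulr0 subr0; lra.
Qed.

Lemma pivot_normal_facets Eb : Eb.1 \subset Y ->
  facets cube_cross_pyramid (cube_cross_pyramid `&` [set y | dotp (pivot_normal Eb) y = 1]).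
Proof.
move=> EY; have N0 := dotp_pivot_normal_gt0 Eb.
set s := (dotp (pivot_normal Eb) (pivot_normal Eb))^-1.
apply: (@facet_of_relative_interior _ _ _ _ (s *: pivot_normal Eb) 1 (s / 2)).
- apply: contraTneq N0 => ->; rewrite /dotp big1 ?ltxx // => j _.
  by rewrite mxE mul0r.
- move=> y; rewrite cube_cross_pyramid_polyhedron => /(_ (pivot_normal Eb, 1)); apply.
  rewrite mem_cat; apply/orP; left; apply/mapP; exists (Eb.1, i0, Eb.2) => //.
  by rewrite mem_enum !inE EY i0X.
- by rewrite dotpZ mulVf // gt_eqF.
- by rewrite divr_gt0 ?invr_gt0.
by move=> y; exact: facet_relative_interior.
Qed.

(** If u and u' cut out the same facet, the point u / |u|^2 lies on both
    hyperplanes, hence u.u' = |u|^2 = |u'|^2 and |u - u'|^2 = 0. *)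
Lemma pivot_normal_inj : {in finset.setX (powerset Y) [set: bool]%SET &,
  injective (fun Eb => cube_cross_pyramid `&` [set y | dotp (pivot_normal Eb) y = 1])}.
Proof.
move=> Eb Eb'; rewrite !inE !andbT => EY EY' FF'.
pose u := pivot_normal Eb; pose u' := pivot_normal Eb'.
have N0 : 0 < dotp u u := dotp_pivot_normal_gt0 Eb.
have NN : dotp u' u' = dotp u u by rewrite !dotp_pivot_normal.
pose x := (dotp u u)^-1 *: u.
have xu : dotp u x = 1 by rewrite dotpZ mulVf // gt_eqF.
have Fx : (cube_cross_pyramid `&` [set y | dotp u y = 1]) x.
  split=> //; apply: (@facet_relative_interior Eb) => // i.
  by rewrite subrr normr0 divr_ge0 ?invr_ge0 // ltW.
have u'u : dotp u' u = dotp u u.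
  move: Fx; rewrite FF' => -[_ /=]; rewrite dotpZ => /(congr1 ( *%R (dotp u u))).
  by rewrite mulr1 mulVKf // gt_eqF.
have : u - u' == 0.
  apply: contraTT isT => /dotp_self_neq0.
  by rewrite dotpB !(dotpC (u - u')) !dotpB NN (dotpC u u') u'u !subrr eqxx.
rewrite subr_eq0 => /eqP/rowP uu'.
rewrite [Eb]surjective_pairing [Eb']surjective_pairing; congr (_, _).
  apply/setP => j; have := uu' j; rewrite !mxE; case: ifPn => [jX _|_ /sign_inj //].
  have jY : j \notin Y by apply: contraL jX => /XY.
  by rewrite !(contraNF (fintype.subsetP _ _) jY).
by have := uu' i0; rewrite !mxE i0X eqxx => /sign_inj.
Qed.

Lemma card_facets_cube_cross_pyramid :
  (2 ^ #|Y|.+1 <= cardset (facets cube_cross_pyramid) <= 2 ^ #|Y|.+1 * (3 * n))%N.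
Proof.
apply/andP; split; last first.
  exact: leq_trans (cardset_le_size facets_cube_cross_pyramid_sub) size_inequalities.
rewrite expnSr -card_powerset -card_bool -cardsT -cardsX.
apply: (card_le_cardset (f := fun Eb =>
  cube_cross_pyramid `&` [set y | dotp (pivot_normal Eb) y = 1])).
- exact: finite_set_sub_image facets_cube_cross_pyramid_sub.
- by move=> Eb; rewrite !inE andbT => EY; exact: pivot_normal_facets.
exact: pivot_normal_inj.
Qed.

End CubeCrossPyramid.

(** * Dimensions that grow like a power of n *)

Section Growth.
Context {R : realType}.
Implicit Types b : R.

(** Used through half_power b n + 1, since the floor of n^b / 2 may vanish while
    n^b is at least 1. *)
Definition half_power b n : nat := Num.trunc ((n%:R : R) `^ b / 2).

Lemma natr_powR_ge1 b n : 0 <= b -> (0 < n)%N -> 1 <= (n%:R : R) `^ b.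
Proof.
move=> b0 n0; rewrite -[leLHS](powRr0 n%:R); apply: ler_powR => //.
by rewrite ler1n.
Qed.

Lemma half_power_bounds b n : 0 <= b -> (0 < n)%N ->
  n%:R `^ b / 2 <= ((half_power b n).+1%:R : R) <= 2 * n%:R `^ b.
Proof.
move=> b0 n0; have x1 := natr_powR_ge1 b0 n0.
have x0 : 0 <= n%:R `^ b / 2 :> R by rewrite divr_ge0 ?powR_ge0.
have /andP[lo hi] := truncn_itv x0; rewrite (ltW hi) /=.
rewrite -natr1 -/(half_power b n); rewrite -/(half_power b n) in lo; lra.
Qed.

(** With x = n^a and y = n^(1-a), x y = n and (x - 1) (y - 1) >= 0 give
    x + y <= n + 1, so the left-hand side is at most (n + 3) / 2.  For n = 1 the
    floors are both 0. *)
Lemma half_power_add a n : 0 < a -> a < 1 -> (0 < n)%N ->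
  ((half_power a n).+1 + half_power (1 - a) n <= n)%N.
Proof.
move=> a0 a1 n0.
have x1 := @natr_powR_ge1 a n (ltW a0) n0.
have y1 : 1 <= (n%:R : R) `^ (1 - a) by apply: natr_powR_ge1 => //; lra.
have xy : n%:R `^ a * n%:R `^ (1 - a) = n%:R :> R.
  by rewrite -powRD ?subrKC ?powRr1 // oner_eq0.
set x := n%:R `^ a in x1 xy; set y := n%:R `^ (1 - a) in y1 xy.
have hx : (half_power a n)%:R <= x / 2 by rewrite truncn_le divr_ge0 ?powR_ge0.
have hy : (half_power (1 - a) n)%:R <= y / 2 by rewrite truncn_le divr_ge0 ?powR_ge0.
have : (2 * (half_power a n + half_power (1 - a) n))%:R <= n.+1%:R :> R.
  rewrite natrM natrD -[n.+1%:R]natr1 -xy.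
  have : 0 <= (x - 1) * (y - 1) by rewrite mulr_ge0 ?subr_ge0.
  by lra.
rewrite ler_nat; have [n1|n1] := leqP 2 n; first by lia.
have -> : n = 1%N by lia.
rewrite /half_power !powR1 (_ : Num.trunc (1 / 2) = 0%N) //.
by apply: truncn_def; lra.
Qed.

(** The factor 3 n is harmless since ln n = ln (n^b) / b <= n^b / b. *)
Lemma asymp_ln_half_power b (N : nat -> nat) : 0 < b ->
  (forall n, (0 < n)%N ->
    (2 ^ (half_power b n).+1 <= N n <= 2 ^ (half_power b n).+1 * (3 * n))%N) ->
  asymp (fun n => ln ((N n)%:R : R)) (fun n => n%:R `^ b).
Proof.
move=> b0 NB; have ln2 : 0 < ln (2 : R) by rewrite ln_gt0 // ltr1n.
have ln3 : 0 < ln (3 : R) by rewrite ln_gt0 // ltr1n.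
exists (ln 2 / 2), (2 * ln 2 + ln 3 + b^-1); split.
- by rewrite divr_gt0.
- by rewrite !addr_gt0 ?invr_gt0 ?mulr_gt0.
move=> n n0; have /andP[Nlo Nhi] := NB n n0.
have x1 := natr_powR_ge1 (ltW b0) n0.
have lnn : ln (n%:R : R) <= b^-1 * n%:R `^ b.
  rewrite ler_pdivlMl // -ln_powR; move: x1; move: (n%:R `^ b) => x x1.
  have /le_ln1Dx : -1 < x - 1 by lra.
  by rewrite subrKC; move: (ln x) => y; lra.
have := half_power_bounds (ltW b0) n0; move: Nlo Nhi.
move: (half_power b n).+1 => m Nlo Nhi /andP[mlo mhi].
have m2 : 0 < (2 ^ m)%:R :> R by rewrite ltr0n expn_gt0.
have N0 : 0 < (N n)%:R :> R by rewrite ltr0n (leq_trans _ Nlo) // expn_gt0.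
have nR : 0 < n%:R :> R by rewrite ltr0n.
have ln2m : ln ((2 ^ m)%:R : R) = m%:R * ln 2 by rewrite natrX lnXn // mulr_natl.
have lnlo : m%:R * ln 2 <= ln ((N n)%:R : R).
  by rewrite -ln2m ler_ln ?posrE // ler_nat.
have lnhi : ln ((N n)%:R : R) <= m%:R * ln 2 + (ln 3 + ln n%:R).
  rewrite -ln2m -!lnM ?posrE // ?mulr_gt0 // -!natrM ler_ln ?posrE ?ler_nat //.
  by rewrite ltr0n !muln_gt0 expn_gt0 n0.
move: (n%:R `^ b) x1 mlo mhi lnn => x x1 mlo mhi lnn; apply/andP; split.
  by move: (m%:R : R) (ln 2 : R) (ln _) mlo lnlo ln2 => {mhi lnhi} M l z mlo lnlo ln2; nra.
have mln : m%:R * ln 2 <= 2 * x * ln 2 by rewrite ler_wpM2r // ltW.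
have ln3x : ln 3 <= ln 3 * x by rewrite ler_peMr // ltW.
by lra.
Qed.

End Growth.

(** * Polytopes with prescribed growth of the face numbers *)

Lemma disjoint_subsets_of_card n p q : (p + q <= n)%N ->
  exists X Y : {set 'I_n}, [/\ #|X| = p, #|Y| = q & {in Y, forall j, j \notin X}].
Proof.
move=> pqn; pose f (j : 'I_p) := widen_ord pqn (lshift q j).
pose g (j : 'I_q) := widen_ord pqn (rshift p j).
exists (f @: [set: 'I_p])%SET, (g @: [set: 'I_q])%SET; split.
- rewrite card_imset ?cardsT ?card_ord // => i j /(congr1 val) /= ij.
  exact: val_inj.
- rewrite card_imset ?cardsT ?card_ord // => i j /(congr1 val) /= /addnI ij.
  exact: val_inj.
move=> j /imsetP[k _ ->]; apply/imsetP => -[l _] /(congr1 val) /= kl.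
by have := ltn_ord l; rewrite -kl ltnNge leq_addr.
Qed.

Lemma exists_polytope_card (R : realType) n p q :
  (0 < p)%N -> (p + q <= n)%N ->
  exists P : set 'rV[R]_n, [/\ polytope P,
    (2 ^ p <= cardset (vertices P) <= 2 ^ p * (3 * n))%N &
    (2 ^ q.+1 <= cardset (facets P) <= 2 ^ q.+1 * (3 * n))%N].
Proof.
move=> p0 /disjoint_subsets_of_card[X [Y [pX qY XY]]].
have /card_gt0P[i0 i0X] : (0 < #|X|)%N by rewrite pX.
exists (cube_cross_pyramid X Y); split.
- exact: polytope_cube_cross_pyramid i0X.
- by rewrite -pX; exact: card_vertices_cube_cross_pyramid i0X.
- by rewrite -qY; exact: card_facets_cube_cross_pyramid XY i0X.
Qed.

Theorem proposition4p1 (R : realType) (a : R) (a_gt0 : 0 < a) (a_lt1 : a < 1) :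
  exists P : forall n : nat, set 'rV[R]_n,
    [/\ forall n, (0 < n)%N -> polytope (P n),
        asymp (fun n => ln ((cardset (vertices (P n)))%:R : R))
              (fun n => n%:R `^ a) &
        asymp (fun n => ln ((cardset (facets (P n)))%:R : R))
              (fun n => n%:R `^ (1 - a))].
Proof.
have exP n : exists P : set 'rV[R]_n, (0 < n)%N -> [/\ polytope P,
    (2 ^ (half_power a n).+1 <= cardset (vertices P)
       <= 2 ^ (half_power a n).+1 * (3 * n))%N &
    (2 ^ (half_power (1 - a) n).+1 <= cardset (facets P)
       <= 2 ^ (half_power (1 - a) n).+1 * (3 * n))%N].
  case: n => [|n]; first by exists setT.
  have [//|P PH] := @exists_polytope_card R n.+1 _ _ _
    (half_power_add a_gt0 a_lt1 (ltn0Sn n)).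
  by exists P.
pose P n := sval (cid (exP n)).
have PH n n0 := svalP (cid (exP n)) n0; exists P; split.
- by move=> n /PH[].
- by apply: asymp_ln_half_power => // n /PH[].
- by apply: asymp_ln_half_power; [rewrite subr_gt0|move=> n /PH[]].
Qed.
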